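(* Let $d\ge4$ be an integer, put $a=\lfloor (d-4)/2\rfloor$, $b=\lceil (d-4)/2\rceil$, $\gamma=(a,0,b,0)\in\mathbb N^4$, and for $f\in\mathcal L_{4,d}^+$ with normalized coefficients $c_\alpha$ let $$R_d(f)=\frac{c_{\gamma+(1,0,3,0)}\,c_{\gamma+(3,0,1,0)}\,c_{\gamma+(0,2,0,2)}}{c_{\gamma+(2,0,2,0)}\,c_{\gamma+(1,0,1,2)}\,c_{\gamma+(1,2,1,0)}}.$$ Let $w_d\in\mathbb R^{\Delta_4^d}$ be the exponent vector of $R_d$ (entry $+1$ at the three numerator indices, $-1$ at the three denominator indices, $0$ elsewhere). Let $\mu_d(s)=\min\{s,d-s\}$ for $0\le s\le d$, let $\alpha^*=\gamma+(2,0,2,0)$, let $\epsilon_d=2$ if $d$ is even and $\epsilon_d=1$ if $d$ is odd, and define $q_d\in\mathbb R^{\Delta_4^d}$ by $$q_d(\alpha)=\mu_d(\alpha_2+\alpha_3)+\mu_d(\alpha_3+\alpha_4)-\epsilon_d\,\mathbf 1_{\{\alpha=\alpha^*\}}.$$ Then $$w_d\in\operatorname{BR}(\mathcal L_{4,d}^+)\setminus\operatorname{Cone}\bigl(\mathcal G_4(\Delta_4^d)\bigr).$$ More precisely, $R_d(f)\le 64$ for every $f\in\mathcal L_{4,d}^+$, and $$\langle w_d,q_d\rangle=\epsilon_d>0,\qquad q_d\in\operatorname{Cone}\bigl(\mathcal G_4(\Delta_4^d)\bigr)^\circ.$$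
   Context: Notation: $\mathbb N=\mathbb Z_{\ge0}$, $[n]=\{1,\dots,n\}$, $e_i$ is the $i$-th standard basis vector of $\mathbb R^n$; for $\alpha\in\mathbb N^n$, $|\alpha|=\alpha_1+\cdots+\alpha_n$, $\alpha!=\alpha_1!\cdots\alpha_n!$, and $\mathbf x^\alpha=x_1^{\alpha_1}\cdots x_n^{\alpha_n}$; $\Delta_n^d=\{\alpha\in\mathbb N^n:|\alpha|=d\}$. For a finite set $S$, $\varepsilon_\alpha$ ($\alpha\in S$) denotes the standard basis of $\mathbb R^S$, and $\langle w,q\rangle=\sum_{\alpha\in S}w_\alpha q_\alpha$ (with $q_\alpha=q(\alpha)$). $\operatorname{Cone}(E)$ is the set of finite nonnegative linear combinations of elements of $E$. The polar of $C\subseteq\mathbb R^S$ is $C^\circ=\{q\in\mathbb R^S:\langle w,q\rangle\le0\text{ for all }w\in C\}$. A nonempty set $S\subseteq\Delta_n^d$ is $M$-convex if, whenever $\alpha,\beta\in S$ and $\alpha_i>\beta_i$, there is $j$ with $\alpha_j<\beta_j$ such that $\alpha-e_i+e_j\in S$ and $\beta-e_j+e_i\in S$. Lorentzian polynomials: for $d\ge2$, a polynomial $f=\sum_{\alpha\in\Delta_n^d}c_\alpha\,\mathbf x^\alpha/\alpha!$ with all $c_\alpha\ge0$, not identically zero, is Lorentzian if and only if its support $\{\alpha:c_\alpha\ne0\}$ is $M$-convex and for every $\beta\in\Delta_n^{d-2}$ the symmetric matrix $H_\beta(f)=(c_{\beta+e_i+e_j})_{1\le i,j\le n}$ (the Hessian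 of $\partial^\beta f$) has at most one positive eigenvalue. The numbers $c_\alpha$ are called the normalized coefficients of $f$. For an $M$-convex $S\subseteq\Delta_n^d$, $\mathcal L_S^+$ is the set of Lorentzian polynomials whose normalized coefficients $c_\alpha$ are positive exactly for $\alpha\in S$; $\mathcal L_{n,d}^+:=\mathcal L_{\Delta_n^d}^+$. For $w\in\mathbb R^S$ and $f\in\mathcal L_S^+$ put $R_w(f)=\prod_{\alpha\in S}c_\alpha^{w_\alpha}$, and $\operatorname{BR}(\mathcal L_S^+)=\{w\in\mathbb R^S:\sup_{f\in\mathcal L_S^+}R_w(f)<\infty\}$. Quadratic local generators: for $\beta\in\Delta_n^{d-2}$ let $S_\beta=\{e_i+e_j:i,j\in[n],\ \beta+e_i+e_j\in S\}\subseteq\Delta_n^2$ (which is $M$-convex whenever nonempty; for $S=\Delta_n^d$ it is $\Delta_n^2$). For $v\in\mathbb R^{S_\beta}$ let $\widetilde v^{\,\beta}=\sum_{\gamma\in S_\beta}v_\gamma\varepsilon_{\beta+\gamma}\in\mathbb R^S$. Then $\mathcal G_n(S)=\bigcup_{\beta\in\Delta_n^{d-2},\,S_\beta\ne\varnothing}\{\widetilde v^{\,\beta}:v\in\operatorname{BR}(\mathcal L_{S_\beta}^+)\}$. *)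

(* Defs.v *)
From mathcomp Require Import all_boot all_order all_algebra finmap.
From mathcomp Require Import all_classical all_reals all_analysis.
(* The notations of mpoly clash with those of MathComp-Analysis. *)
From mathcomp Require Import -(notations) mpoly.

Set Implicit Arguments.
Unset Strict Implicit.
Unset Printing Implicit Defensive.

Import Order.TTheory GRing.Theory Num.Theory.

Local Open Scope classical_set_scope.
Local Open Scope fset_scope.
Local Open Scope ring_scope.

Declare Scope mnm_scope.
Delimit Scope mnm_scope with mnm.
Notation "a + b" := (mnm_add a b) : mnm_scope.
Notation "a - b" := (mnm_sub a b) : mnm_scope.
Notation "''e_' i" := (mnm1 i) (at level 8, i at level 2, format "''e_' i")
  : mnm_scope.

Definition simplex (n d : nat) : {fset multinom n} :=
  [fset bmnm a | a : bmultinom n d.+1 & mdeg a == d].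

Lemma in_simplex n d (a : multinom n) : (a \in simplex n d) = (mdeg a == d).
Proof.
apply/imfsetP/idP => [[b /andP[_ hb] ->] //|ha].
have lt_ad : (mdeg a < d.+1)%N by rewrite (eqP ha).
by exists (BMultinom lt_ad) => //; apply/andP; split.
Qed.

(* The subtractions of exponents below are never truncated:
   b i < a i in the first one, a j < b j in the second one. *)
Definition Mconvex (n : nat) (S : {fset multinom n}) : Prop :=
  S != fset0 /\
  forall a b, a \in S -> b \in S -> forall i, (b i < a i)%N ->
    exists j, [/\ (a j < b j)%N,
                  (a - 'e_i + 'e_j)%mnm \in S
                & (b - 'e_j + 'e_i)%mnm \in S].

(* The eigenvalues are counted with multiplicity. The matrices to which this
   is applied are real symmetric, so that the dimension of an eigenspace is
   the multiplicity of the eigenvalue in the characteristic polynomial. *)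
Definition at_most_one_pos_eigenvalue (R : realType) (n : nat) (A : 'M[R]_n)
    : Prop :=
  forall s : seq R, uniq s -> {in s, forall x, 0 < x /\ eigenvalue A x} ->
    (\sum_(x <- s) \rank (eigenspace A x) <= 1)%N.

Section Lorentzian.
Context {R : realType} {n : nat}.
Implicit Types (f : mpoly n R) (a b : multinom n).

Definition mfact a : nat := (\prod_(i < n) (a i)`!)%N.

(* f = \sum_a (ncoeff f a) x^a / a! *)
Definition ncoeff f a : R := (mfact a)%:R * mcoeff a f.

Definition supp (d : nat) f : {fset multinom n} :=
  [fset a in simplex n d | ncoeff f a != 0].

Definition hess f b : 'M[R]_n := \matrix_(i, j) ncoeff f (b + 'e_i + 'e_j)%mnm.

(* Only meaningful for d >= 2, because of the truncated subtraction d - 2. *)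
Definition lorentzian (d : nat) f : Prop :=
  [/\ f \is ishomog1 d (@mdeg n) /\ f != 0,
      forall a, a \in simplex n d -> 0 <= ncoeff f a,
      Mconvex (supp d f)
    & forall b, b \in simplex n (d - 2) ->
        at_most_one_pos_eigenvalue (hess f b)].

Definition lorentzian_pos (d : nat) (S : {fset multinom n})
    : set (mpoly n R) :=
  [set f | lorentzian d f /\
           forall a, a \in simplex n d -> 0 < ncoeff f a <-> a \in S].

Definition Rw (S : {fset multinom n}) (w : {ffun S -> R}) f : R :=
  \prod_(a : S) ncoeff f (val a) `^ w a.

Definition BR (d : nat) (S : {fset multinom n}) : set {ffun S -> R} :=
  [set w | (ereal_sup [set (Rw w f)%:E | f in lorentzian_pos d S]
            < +oo)%E].

Definition link (S : {fset multinom n}) b : {fset multinom n} :=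
  [fset ('e_i + 'e_j)%mnm | i : 'I_n, j : 'I_n & (b + ('e_i + 'e_j))%mnm \in S].

Definition extend (S : {fset multinom n}) b (v : {ffun link S b -> R})
    : {ffun S -> R} :=
  [ffun a : S => \sum_(g : link S b) v g * (val a == (b + val g)%mnm)%:R].

Definition generators (d : nat) (S : {fset multinom n}) : set {ffun S -> R} :=
  \bigcup_(b in [set b | b \in simplex n (d - 2) /\ link S b != fset0])
    [set extend v | v in @BR 2 (link S b)].

End Lorentzian.

Arguments BR {R n} d S _.
Arguments generators {R n} d S _.

Section Cone.
Context {R : realType} {I : finType}.

Definition pairing (w q : {ffun I -> R}) : R := \sum_(a : I) w a * q a.

Definition cone (E : set {ffun I -> R}) : set {ffun I -> R} :=
  [set w | exists (k : nat) (l : 'I_k -> R) (u : 'I_k -> {ffun I -> R}),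
     (forall t, 0 <= l t /\ E (u t)) /\
     w = [ffun a => \sum_(t < k) l t * u t a]].

Definition polar (C : set {ffun I -> R}) : set {ffun I -> R} :=
  [set q | forall w, C w -> pairing w q <= 0].

End Cone.

Definition mnm4 (i j k l : nat) : multinom 4 := Multinom [tuple i; j; k; l].

Definition gam (d : nat) : multinom 4 := mnm4 (d - 4)./2 0 (uphalf (d - 4)) 0.

Definition num_idx (d : nat) : seq (multinom 4) :=
  [:: (gam d + mnm4 1 0 3 0)%mnm; (gam d + mnm4 3 0 1 0)%mnm;
      (gam d + mnm4 0 2 0 2)%mnm].

Definition alpha_star (d : nat) : multinom 4 := (gam d + mnm4 2 0 2 0)%mnm.

Definition den_idx (d : nat) : seq (multinom 4) :=
  [:: alpha_star d; (gam d + mnm4 1 0 1 2)%mnm; (gam d + mnm4 1 2 1 0)%mnm].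

Definition mu (d s : nat) : nat := minn s (d - s).

Definition eps (d : nat) : nat := if odd d then 1 else 2.

Section Obstruction.
Context {R : realType}.

Definition Rd (d : nat) (f : mpoly 4 R) : R :=
  let c a := ncoeff f (gam d + a)%mnm in
  (c (mnm4 1 0 3 0) * c (mnm4 3 0 1 0) * c (mnm4 0 2 0 2))
  / (c (mnm4 2 0 2 0) * c (mnm4 1 0 1 2) * c (mnm4 1 2 1 0)).

Definition wd (d : nat) : {ffun simplex 4 d -> R} :=
  [ffun a => if val a \in num_idx d then 1
             else if val a \in den_idx d then -1 else 0].

(* The coordinates alpha_1, ..., alpha_4 are those of index 0, ..., 3. *)
Definition qd (d : nat) : {ffun simplex 4 d -> R} :=
  [ffun a => let x k := (val a : multinom 4) (inord k) in
     (mu d (x 1 + x 2)%N)%:R + (mu d (x 2 + x 3)%N)%:R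
     - (eps d)%:R * (val a == alpha_star d)%:R].

End Obstruction.

(* Main.v *)
(* Upper bound: a symmetric matrix with positive entries and at most one
   positive eigenvalue satisfies the reverse Cauchy-Schwarz inequality
   q(x,x) q(y,y) <= q(x,y)^2 for q(x,x) > 0. Two choices of x and y give
     q_ii q_jk <= 2 q_ij q_ik  and  q_ij q_kl <= 2 (q_ik q_jl + q_il q_jk).
   The second one for the Hessian at gamma + (0,1,0,1) bounds
   c_1111 c_0202 (indices relative to gamma) by a sum of two products; each of
   these is bounded by the denominator of R_d after multiplying four
   inequalities of the first kind: 2 (2^4 + 2^4) = 64.

   Polarity: for a set A of variables, k >= 0 and t >= 0, the quadratic form
   with normalized coefficients exp (t (l(a) + k [a(A) = 1])), l linear, is
   Lorentzian, because its Gram matrix has the signature of ((1,T),(T,1)) with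
   T = exp (t k) >= 1. Letting t grow, every w in BR pairs nonpositively with
   the "cut functions" l(a) + k [a(A) = 1]. Each local restriction of q_d is a
   sum of such functions: up to linear functions, mu_d contributes cuts along
   {2,3} and {3,4}, the corrections at alpha^* - 2 e_i are cuts along {i}, and at
   alpha^* - e_1 - e_3 the identity
   cut_{2,3} + cut_{3,4} - 2 [e_1 + e_3] = cut_{2} + cut_{4} absorbs the
   correction. *)
Require Import Defs.
From mathcomp Require Import all_boot all_order all_algebra finmap.
From mathcomp Require Import all_classical all_reals all_analysis.
From mathcomp Require Import -(notations) mpoly.
From mathcomp Require Import spectral sesquilinear complex zify ring lra.

Import Order.TTheory GRing.Theory Num.Theory.

Local Open Scope classical_set_scope.
Local Open Scope ring_scope.

(** * Reverse Cauchy-Schwarz inequalities *)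

Section Signature.
Context {R : realType} {n : nat}.
Implicit Types (A : 'M[R]_n) (x y : 'rV[R]_n).
Local Open Scope sesquilinear_scope.

Definition qform A x y : R := (x *m A *m y^T) 0 0.

Local Notation toC := (map_mx (real_complex R)).

Lemma map_realC_conj m p (B : 'M[R]_(m, p)) : (toC B)^t* = toC B^T.
Proof.
apply/matrixP => i j; rewrite !mxE; apply/CrealP.
by apply/complex_realP; exists (B j i).
Qed.

Lemma symmetric_map_hermitian {A} : A^T = A -> toC A \is hermsymmx.
Proof.
move=> hA; apply: realsym_hermsym.
  by apply/is_hermitianmxP; rewrite expr0 scale1r map_mx_id// map_trmx hA.
by apply/mxOverP => i j; rewrite mxE; apply/complex_realP; exists (A i j).
Qed.

Lemma sub_eigenspace_spectral {A} (hA : A^T = A) i :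
  (row i (spectralmx (toC A)) <=
     eigenspace (toC A) (spectral_diag (toC A) 0 i))%MS.
Proof.
have /hermitian_normalmx/orthomx_spectralP e := symmetric_map_hermitian hA.
move: (spectral_unit (toC A)) e; set P := spectralmx _; set D := spectral_diag _.
move=> hP e; apply/eigenspaceP; rewrite -row_mul e !mulmxA mulmxV//.
by rewrite mul1mx; apply/rowP => j; rewrite mul_diag_mx !mxE.
Qed.

(** Complex scalars leave the ranks of the eigenspaces unchanged. Two positive diagonal entries
    would come with two orthonormal rows of the spectral matrix: inside one eigenspace of rank at
    least 2 if the entries agree, otherwise in the eigenspaces of two different positive
    eigenvalues. *)
Lemma spectral_diag_pos_unique {A} (i j : 'I_n) : A^T = A ->
  at_most_one_pos_eigenvalue A ->
  0 < spectral_diag (toC A) 0 i -> 0 < spectral_diag (toC A) 0 j -> i = j.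
Proof.
move=> hA h1 hi hj; apply/eqP/negPn/negP => ij.
set P := spectralmx (toC A); set D := spectral_diag (toC A) in hi hj.
have /row_unitarymxP hP := spectral_unitarymx (toC A).
have [r hr] : exists r : R, D 0 i = r%:C%C by apply/complex_realP; rewrite gtr0_real.
have [s hs] : exists s : R, D 0 j = s%:C%C by apply/complex_realP; rewrite gtr0_real.
have r0 : 0 < r by rewrite -ltcR -hr.
have s0 : 0 < s by rewrite -ltcR -hs.
have P0 k : row k P != 0.
  apply/eqP => e; have := hP k k; rewrite -/P e eqxx dotmxE mul0mx mxE.
  by move/esym/eqP; rewrite oner_eq0.
have si := sub_eigenspace_spectral hA i; rewrite -/P -/D hr in si.
have sj := sub_eigenspace_spectral hA j; rewrite -/P -/D hs in sj.
have rk t : \rank (eigenspace A t) = \rank (eigenspace (toC A) t%:C%C).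
  by rewrite -map_eigenspace mxrank_map.
have rk1 t k : (row k P <= eigenspace (toC A) t%:C%C)%MS ->
    (0 < \rank (eigenspace A t))%N.
  move=> /mxrankS; rewrite -rk; apply: leq_trans.
  by rewrite lt0n mxrank_eq0.
have ev t k : (row k P <= eigenspace (toC A) t%:C%C)%MS -> eigenvalue A t.
  by move=> /rk1; rewrite lt0n mxrank_eq0.
have [e|rs] := eqVneq r s.
  have := h1 [:: r] isT; rewrite big_seq1 => /(_ _)/wrap[].
    by move=> x; rewrite inE => /eqP ->; split => //; exact: ev si.
  apply/negP; rewrite -ltnNge rk.
  pose N : 'M[R[i]]_(2, n) := \matrix_(k < 2) row (if k == 0 then i else j) P.
  have : N \is unitarymx.
    apply/row_unitarymxP => k l; rewrite !rowK hP; congr (_%:R).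
    case: k => [[|[|//]] ?]; case: l => [[|[|//]] ?]; rewrite ?eqxx//=.
      by rewrite (negbTE ij).
    by rewrite eq_sym (negbTE ij).
  move=> /mxrank_unitary <-; apply/mxrankS/row_subP => k; rewrite rowK.
  by case: ifP => _; [exact: si | rewrite e; exact: sj].
have := h1 [:: r; s]; rewrite big_cons big_seq1 /= inE rs => /(_ isT)/(_ _)/wrap[].
  move=> x; rewrite !inE => /orP[] /eqP ->; split => //.
    exact: ev si.
  exact: ev sj.
apply/negP; rewrite -ltnNge -[2%N]/(1 + 1)%N leq_add//.
  exact: rk1 si.
exact: rk1 sj.
Qed.

Local Notation hform A z := ((z *m toC A *m z^t*) 0 0).

Lemma hform_spectral {A} (hA : A^T = A) (z : 'rV[R[i]]_n) :
  hform A z = \sum_j spectral_diag (toC A) 0 j *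
                `|(z *m (spectralmx (toC A))^t*) 0 j| ^+ 2.
Proof.
have /hermitian_normalmx/orthomx_spectralP e := symmetric_map_hermitian hA.
move: (spectral_unitarymx (toC A)) e.
set P := spectralmx _; set D := spectral_diag _ => hP ->.
rewrite invmx_unitary//; set w := z *m P^t*.
have -> : z *m (P^t* *m diag_mx D *m P) *m z^t* = w *m diag_mx D *m w^t*.
  by rewrite /w trmx_mul map_mxM trmxCK !mulmxA.
rewrite mxE; apply: eq_bigr => j _.
by rewrite mul_mx_diag !mxE normCK mulrAC mulrC.
Qed.

Lemma qform_sym {A} (hA : A^T = A) x y : qform A x y = qform A y x.
Proof.
by rewrite /qform -[x *m A *m _]trmxK mxE !trmx_mul trmxK hA mulmxA.
Qed.

(** The cross terms cancel by symmetry of [A]. This brings back to real vectors an estimate made in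
    the complex spectral basis. *)
Lemma hform_real_imaginary {A} (hA : A^T = A) x y :
  hform A (toC x + 'i *: toC y) = (qform A x x + qform A y y)%:C%C.
Proof.
have -> : (toC x + 'i *: toC y)^t* = toC x^T - 'i *: toC y^T.
  by rewrite -!map_realC_conj linearD linearZ /= map_mxD map_mxZ /= conjCi scaleNr.
have realE u v : (toC u *m toC A *m toC v^T) 0 0 = (qform A u v)%:C%C.
  by rewrite -!map_mxM mxE.
rewrite !mulmxDl mulmxBr -!scalemxAl -!scalemxAr mulmxBr -scalemxAr.
rewrite scalerBr scalerA -expr2 sqrCi scaleN1r opprK.
move: (realE x x) (realE x y) (realE y x) (realE y y).
move: (_ *m _ *m _) (_ *m _ *m _) (_ *m _ *m _) (_ *m _ *m _) => M1 M2 M3 M4.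
rewrite !mxE => -> -> -> ->; rewrite (qform_sym hA y x) rmorphD /=.
by ring.
Qed.

Lemma qform_comb A (a b : R) x y : A^T = A ->
  qform A (a *: x + b *: y) (a *: x + b *: y) =
    a ^+ 2 * qform A x x + 2 * a * b * qform A x y + b ^+ 2 * qform A y y.
Proof.
move=> hA; transitivity (a * a * qform A x x + a * b * qform A x y +
    (a * b * qform A y x + b * b * qform A y y)); last first.
  by rewrite (qform_sym hA y x); ring.
rewrite /qform linearD !linearZ /= !(mulmxDl, mulmxDr) -!scalemxAl -!scalemxAr.
move: (_ *m _ *m _) (_ *m _ *m _) (_ *m _ *m _) (_ *m _ *m _) => M1 M2 M3 M4.
by rewrite !mxE; ring.
Qed.

(** The form is nonpositive where the coordinate [c] along the only positive spectral direction
    vanishes. As the form is positive at [x], [c x] is nonzero, and subtracting [y] from a multiple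
    of [x] reaches that hyperplane. *)
Lemma reverse_cauchy_schwarz A x y : A^T = A ->
  at_most_one_pos_eigenvalue A -> 0 < qform A x x ->
  qform A x x * qform A y y <= qform A x y ^+ 2.
Proof.
move=> hA h1 x0.
pose P := spectralmx (toC A); pose D := spectral_diag (toC A).
have Dreal j : D 0 j \is Num.real.
  exact: (mxOverP (hermitian_spectral_diag_real (symmetric_map_hermitian hA))).
have h0 (z : 'rV[R[i]]_n) :
    (forall j, 0 < D 0 j -> (z *m P^t*) 0 j = 0) -> hform A z <= 0.
  move=> hz; rewrite (hform_spectral hA); apply: sumr_le0 => j _.
  have [Dj|Dj] := real_ltP (real0 _) (Dreal j).
    by rewrite hz// normr0 expr0n mulr0.
  by rewrite mulr_le0_ge0// exprn_ge0.
have hx : ~ hform A (toC x) <= 0.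
  have := hform_real_imaginary hA x 0.
  have -> : qform A 0 0 = 0 by rewrite /qform !mul0mx mxE.
  rewrite map_mx0 scaler0 !addr0 => ->.
  by rewrite lecR leNgt x0.
have [i Di|D0] := pickP (fun j => 0 < D 0 j); last first.
  by case: hx; apply: h0 => j; rewrite D0.
set c := fun u : 'rV[R]_n => (toC u *m P^t*) 0 i.
have [cx0|cx0] := eqVneq (c x) 0.
  by case: hx; apply: h0 => j Dj; rewrite (spectral_diag_pos_unique j i hA h1 Dj Di).
(* The combination (c y / c x) x - y lies in the hyperplane c = 0, where the
   Hermitian form is nonpositive; then so is the value of [qform A] at the real
   part [a *: x - y] of this vector. *)
have [a [b eab]] : exists a b : R, c y / c x = a%:C%C + 'i * b%:C%C.
  have /complex_realP[a ha] := Creal_Re (c y / c x).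
  have /complex_realP[b hb] := Creal_Im (c y / c x).
  by exists a, b; rewrite -ha -hb -Crect.
have : hform A (toC (a *: x - y) + 'i *: toC (b *: x)) <= 0.
  apply: h0 => j Dj; rewrite (spectral_diag_pos_unique j i hA h1 Dj Di).
  rewrite map_mxB !map_mxZ /= scalerA addrAC -scalerDl -eab.
  rewrite mulmxBl -scalemxAl.
  move: cx0; rewrite /c; move: (toC x *m _) (toC y *m _) => u v u0.
  by rewrite !mxE mulfVK// subrr.
rewrite (hform_real_imaginary hA) lecR -scaleN1r -[b *: x]addr0 -[0](scale0r y).
rewrite !qform_comb//; set p := qform A x x in x0 *; set q := qform A x y.
move: (qform A y y) => r h.
(* Multiplied by p, [h] reads (a p - q)^2 + (b p)^2 + p r - q^2 <= 0. *)
have := mulr_ge0_le0 (ltW x0) h.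
by have := sqr_ge0 (a * p - q); have := sqr_ge0 (b * p); lra.
Qed.

Lemma qform_delta A i j : qform A (delta_mx 0 i) (delta_mx 0 j) = A i j.
Proof. by rewrite /qform -rowE trmx_delta -colE !mxE. Qed.

(** Take x = e_i and y = A_ik e_j + A_ij e_k, weighted so that both terms of q(x,y) equal A_ij A_ik.
    In q(y,y) the squares are dropped and only 2 A_ij A_ik A_jk is kept. *)
Lemma lorentz_three_term A i j k : A^T = A -> at_most_one_pos_eigenvalue A ->
  (forall i j, 0 < A i j) -> A i i * A j k <= 2 * (A i j * A i k).
Proof.
move=> hA h1 A0.
have := @reverse_cauchy_schwarz A (delta_mx 0 i)
  (A i k *: delta_mx 0 j + A i j *: delta_mx 0 k) hA h1.
rewrite qform_comb// !qform_delta => /(_ (A0 i i)).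
have -> : qform A (delta_mx 0 i) (A i k *: delta_mx 0 j + A i j *: delta_mx 0 k)
    = 2 * (A i j * A i k).
  rewrite /qform linearD !linearZ /= mulmxDr -!scalemxAr.
  rewrite -rowE trmx_delta trmx_delta -!colE !mxE; ring.
move=> h; rewrite -(ler_pM2l (mulr_gt0 (A0 i j) (A0 i k))).
have := mulr_ge0 (ltW (A0 i i)) (mulr_ge0 (sqr_ge0 (A i j)) (ltW (A0 k k))).
have := mulr_ge0 (ltW (A0 i i)) (mulr_ge0 (sqr_ge0 (A i k)) (ltW (A0 j j))).
lra.
Qed.

Lemma lorentz_four_term A i j k l : A^T = A -> at_most_one_pos_eigenvalue A ->
  (forall i j, 0 < A i j) ->
  A i j * A k l <= 2 * (A i k * A j l + A i l * A j k).
Proof.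
move=> hA h1 A0.
pose sq a b := Num.sqrt (A a b).
have sq0 a b : 0 < sq a b by rewrite sqrtr_gt0.
have sqE a b : A a b = sq a b ^+ 2 by rewrite sqr_sqrtr// ltW.
(* This scaling makes the terms (i,k), (j,l) of [qform A x y] equal, and
   likewise the terms (i,l), (j,k). *)
pose s1 := sq j k * sq j l; pose s2 := sq i k * sq i l.
pose s3 := sq i l * sq j l; pose s4 := sq i k * sq j k.
pose x := s1 *: delta_mx 0 i + s2 *: delta_mx 0 j : 'rV[R]_n.
pose y := s3 *: delta_mx 0 k + s4 *: delta_mx 0 l : 'rV[R]_n.
have [s10 s20 s30 s40] : [/\ 0 < s1, 0 < s2, 0 < s3 & 0 < s4].
  by split; apply: mulr_gt0.
have lb a b u v : 0 < u -> 0 < v -> 2 * u * v * A a b <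
    qform A (u *: delta_mx 0 a + v *: delta_mx 0 b)
            (u *: delta_mx 0 a + v *: delta_mx 0 b).
  move=> u0 v0; rewrite qform_comb// !qform_delta.
  have := mulr_gt0 (exprn_gt0 2 u0) (A0 a a).
  have := mulr_gt0 (exprn_gt0 2 v0) (A0 b b); lra.
have lx := lb i j s1 s2 s10 s20; have ly := lb k l s3 s4 s30 s40.
have x0 : 0 < 2 * s1 * s2 * A i j by rewrite !mulr_gt0.
have y0 : 0 < 2 * s3 * s4 * A k l by rewrite !mulr_gt0.
have := reverse_cauchy_schwarz A x y hA h1 (lt_trans x0 lx).
move=> /(le_trans (ler_pM (ltW x0) (ltW y0) (ltW lx) (ltW ly))).
have -> : qform A x y = s1 * s3 * A i k + s1 * s4 * A i l +
    (s2 * s3 * A j k + s2 * s4 * A j l).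
  rewrite /x /y /qform linearD !linearZ /= !(mulmxDl, mulmxDr).
  rewrite -!scalemxAl -!scalemxAr -!rowE !trmx_delta -!colE !mxE; ring.
rewrite [A i k]sqE [A i l]sqE [A j k]sqE [A j l]sqE /s1 /s2 /s3 /s4.
move: (sq0 i k) (sq0 i l) (sq0 j k) (sq0 j l).
move: (sq i k) (sq i l) (sq j k) (sq j l) => p u v r p0 u0 v0 r0 h.
(* Here s1 s2 s3 s4 = (p u v r)^2 and q(x,y) = 2 p u v r (p r + u v), so [h] amounts to A_ij A_kl <=
   (p r + u v)^2. The square added below accounts for (p r + u v)^2 <= 2 ((p r)^2 + (u v)^2). *)
have c0 : 0 < 4 * (p * u * v * r) ^+ 2 by rewrite mulr_gt0// exprn_gt0// !mulr_gt0.
rewrite -(ler_pM2l c0).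
have := sqr_ge0 (2 * (p * u * v * r) * (p * r - u * v)).
lra.
Qed.

End Signature.

(** Otherwise a plane spanned by eigenvectors with positive eigenvalues, on which the form is
    positive definite, would meet the hyperplane [ell] = 0 in a nonzero vector. *)
Lemma at_most_one_pos_of_hyperplane {R : realType} {n : nat} (A : 'M[R]_n)
    (ell : 'cV[R]_n) : A^T = A ->
  (forall x : 'rV_n, x *m ell = 0 -> qform A x x <= 0) ->
  at_most_one_pos_eigenvalue A.
Proof.
move=> hA hl.
have qE (v w : 'rV_n) (a : R) : v *m A = a *: v ->
    qform A v w = a * (v *m w^T) 0 0.
  by move=> e; rewrite /qform e -scalemxAl mxE.
have nrm (v : 'rV[R]_n) : v != 0 -> 0 < (v *m v^T) 0 0.
  move=> v0; rewrite lt0r; apply/andP; split; last first.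
    by rewrite mxE sumr_ge0// => j _; rewrite mxE -expr2 sqr_ge0.
  apply: contraNneq v0 => /eqP; rewrite mxE psumr_eq0.
    move=> /allP h; apply/eqP/rowP => j; apply/eqP; rewrite mxE.
    by have := h j (mem_index_enum _); rewrite mxE -expr2 sqrf_eq0.
  by move=> j _; rewrite mxE -expr2 sqr_ge0.
have pos (v : 'rV[R]_n) (a : R) : 0 < a -> v != 0 -> v *m A = a *: v -> 0 < qform A v v.
  by move=> a0 v0 /qE ->; rewrite mulr_gt0// nrm.
have lin0 (v : 'rV[R]_n) (a : R) : 0 < a -> v != 0 -> v *m A = a *: v -> v *m ell != 0.
  move=> a0 v0 e; apply/eqP => /hl; apply/negP; rewrite -ltNge.
  exact: pos e.
move=> [|a [|b s]] us hs; first by rewrite big_nil.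
  rewrite big_seq1 leqNgt; apply/negP => r2.
  have [a0 _] := hs a (mem_head _ _).
  (* Dimension count: an eigenspace of rank at least 2 meets a kernel of rank at least n - 1. *)
  have : (0 < \rank (eigenspace A a :&: kermx ell)%MS)%N.
    have := mxrank_sum_cap (eigenspace A a) (kermx ell).
    have := rank_leq_col (eigenspace A a + kermx ell)%MS.
    rewrite mxrank_ker; have := rank_leq_col ell.
    move: (\rank _) (\rank _) (\rank _) (\rank _) r2; lia.
  rewrite lt0n mxrank_eq0 => /rowV0Pn[v].
  rewrite sub_capmx => /andP[/eigenspaceP e /sub_kermxP k0] v0.
  by have := lin0 v a a0 v0 e; rewrite k0 eqxx.
have [a0 /eigenvalueP[v ev v0]] := hs a (mem_head _ _).
have [b0 /eigenvalueP[w ew w0]] : 0 < b /\ eigenvalue A b.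
  by apply: hs; rewrite !inE eqxx orbT.
have ab : a != b by move: us; rewrite /= inE; case: eqVneq.
have o : qform A v w = 0.
  have := qform_sym hA v w; rewrite (qE _ _ _ ev) (qE _ _ _ ew).
  have -> : (w *m v^T) 0 0 = (v *m w^T) 0 0.
    by rewrite -[v *m w^T]trmxK trmx_mul trmxK [RHS]mxE.
  move/eqP; rewrite -subr_eq0 -mulrBl mulf_eq0 subr_eq0 (negbTE ab) /= => /eqP ->.
  by rewrite mulr0.
have lv := lin0 v a a0 v0 ev.
(* This combination is killed by [ell]. Since [o] removes the mixed term, the form there is a sum of
   two squares with positive weights, the second one nonzero. *)
exfalso; have := hl ((w *m ell) 0 0 *: v + (- (v *m ell) 0 0) *: w).
rewrite qform_comb// o mulr0 addr0 mulmxDl -!scalemxAl.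
have -> : (w *m ell) 0 0 *: (v *m ell) + - (v *m ell) 0 0 *: (w *m ell) = 0.
  by apply/matrixP => i j; rewrite !ord1 !mxE; ring.
move=> /(_ erefl); apply/negP; rewrite -ltNge.
have qv := pos v a a0 v0 ev; have qw := pos w b b0 w0 ew.
apply: ltr_wpDl; first by rewrite mulr_ge0 ?sqr_ge0// ltW.
rewrite mulr_gt0// exprn_even_gt0//= oppr_eq0.
apply: contra lv => /eqP e; apply/eqP/matrixP => i j.
by rewrite !ord1 e mxE.
Qed.

(** * Lorentzian quadratic forms attached to cuts *)

Section Multinomials.
Context {n : nat}.
Implicit Types (a b : multinom n).

Lemma mdeg2_sum a : mdeg a = 2 -> exists i j, a = ('e_i + 'e_j)%mnm.
Proof.
have sub1 b k : mdeg b = k.+1 -> exists2 i, b = (b - 'e_i + 'e_i)%mnm &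
    mdeg (b - 'e_i)%mnm = k.
  move=> hb; have [i bi] : exists i, (0 < b i)%N.
    apply/not_existsP => h; have : mdeg b = 0%N.
      by rewrite mdegE big1// => i _; move: (h i); case: (b i).
    by rewrite hb.
  have e : b = (b - 'e_i + 'e_i)%mnm.
    apply/mnmP => j; rewrite mnmDE mnmBE mnm1E.
    by case: eqVneq => [<-|_]; rewrite ?subn0 ?addn0 ?subnK.
  exists i => //; move: hb; rewrite {1}e mdegD mdeg1; lia.
move=> /sub1[i ei /sub1[j ej /eqP]]; rewrite mdeg_eq0 => /eqP e0.
by exists j, i; rewrite {1}ei {1}ej e0; congr (_ + _)%mnm; apply/mnmP => k; rewrite mnmDE mnm0E.
Qed.

Lemma Mconvex_simplex d : simplex n d != fset0 -> Mconvex (simplex n d).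
Proof.
move=> S0; split=> // a b; rewrite !in_simplex => /eqP ha /eqP hb i hi.
have [j hj] : exists j, (a j < b j)%N.
  apply/not_existsP => h; have : (mdeg b < mdeg a)%N.
    rewrite !mdegE (bigD1 i)//= [ltnRHS](bigD1 i)//= -addSn leq_add//.
    by apply: leq_sum => j _; rewrite leqNgt; apply/negP.
  by rewrite ha hb ltnn.
have swap (u v : multinom n) k l : mdeg u = d -> (v k < u k)%N ->
    mdeg (u - 'e_k + 'e_l)%mnm == d.
  move=> hu hk; have e : u = (u - 'e_k + 'e_k)%mnm.
    apply/mnmP => t; rewrite mnmDE mnmBE mnm1E.
    case: eqVneq => [<-|_]; rewrite ?subn0 ?addn0 ?subnK//; lia.
  by rewrite -hu {2}e !mdegD !mdeg1.
by exists j; rewrite !in_simplex hj (swap a b)// (swap b a).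
Qed.

End Multinomials.

Section FromCoefficients.
Context {R : realType} {n : nat}.
Implicit Types (g : multinom n -> R) (a b : multinom n).

(** The type [bmultinom n d.+1] also contains the exponents of degree below d, hence the test on the
    degree. *)
Definition poly_of_ncoeff d g : mpoly n R :=
  \sum_(a : bmultinom n d.+1)
    (if mdeg a == d then g a / (mfact a)%:R else 0) *: mpolyX R a.

Lemma ncoeff_poly_of_ncoeff d g a : mdeg a = d -> ncoeff (poly_of_ncoeff d g) a = g a.
Proof.
move=> ha; rewrite /ncoeff /poly_of_ncoeff.
rewrite (mcoeff_mpoly (fun a => if mdeg a == d then g a / (mfact a)%:R else 0)).
  rewrite /= ha eqxx mulrC divfK// pnatr_eq0 -lt0n.
  by rewrite /mfact; apply: prodn_gt0 => i; exact: fact_gt0.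
by rewrite ha.
Qed.

Lemma poly_of_ncoeff_homog d g : poly_of_ncoeff d g \is ishomog1 d (@mdeg n).
Proof.
apply: rpred_sum => a _; case: eqP => [ha|_].
  by apply: rpredZ; rewrite dhomogX; apply/eqP.
by rewrite scale0r rpred0.
Qed.

(** In degree 2 the only Hessian is the one at exponent 0. [S] is only required to have the elements
    of the simplex, so that it can be a [link], which indexes the type of the vectors in [BR]. *)
Lemma poly_of_ncoeff_lorentzian_pos g (S : {fset multinom n}) :
  S =i simplex n 2 -> S != fset0 ->
  (forall a, 0 < g a) ->
  at_most_one_pos_eigenvalue (\matrix_(i, j) g ('e_i + 'e_j)%mnm : 'M[R]_n) ->
  lorentzian_pos 2 S (poly_of_ncoeff 2 g).
Proof.
move=> hS S0 g0 hg.
have c0 a : a \in simplex n 2 -> 0 < ncoeff (poly_of_ncoeff 2 g) a.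
  by rewrite in_simplex => /eqP ha; rewrite ncoeff_poly_of_ncoeff.
have suppE : supp 2 (poly_of_ncoeff 2 g) = simplex n 2.
  apply/fsetP => a; rewrite !inE /=; case ha : (a \in simplex n 2) => //=.
  by rewrite gt_eqF// c0.
have S1 : simplex n 2 != fset0.
  by move: S0; have -> : S = simplex n 2 by apply/fsetP.
split; last by move=> a ha; rewrite hS ha c0.
split.
- split; first exact: poly_of_ncoeff_homog.
  have [a ha] := fset0Pn _ S1; apply/eqP => f0.
  by have := c0 a ha; rewrite f0 /ncoeff mcoeff0 mulr0 ltxx.
- by move=> a /c0/ltW.
- by rewrite suppE; exact: Mconvex_simplex.
- move=> b; rewrite in_simplex mdeg_eq0 => /eqP ->.
  rewrite /hess; congr at_most_one_pos_eigenvalue: hg.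
  apply/matrixP => i j; rewrite !mxE ncoeff_poly_of_ncoeff.
    by congr g; apply/mnmP => k; rewrite !mnmDE mnm0E.
  by rewrite !mdegD !mdeg1 mdeg0.
Qed.

End FromCoefficients.

Section CutFunctions.
Context {R : realType} {n : nat}.
Implicit Types (l : 'I_n -> R) (k : R) (A : pred 'I_n).

(** On ['e_i + 'e_j] the indicator tells whether the pair {i,j} crosses the cut between [A] and its
    complement. *)
Definition cutlin l k A (a : multinom n) : R :=
  \sum_i l i * (a i)%:R + k * ((\sum_(i | A i) a i)%N == 1%N)%:R.

Lemma sum_U2 A i j : (\sum_(s | A s) ('e_i + 'e_j)%mnm s = A i + A j)%N.
Proof.
have V (t : 'I_n) : (\sum_(s | A s) ('e_t)%mnm s = A t)%N.
  rewrite big_mkcond (bigD1 t)//= big1 ?addn0 => [|s ts].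
    by rewrite mnm1E eqxx; case: (A t).
  by rewrite mnm1E eq_sym (negbTE ts) if_same.
by rewrite (eq_bigr _ (fun s _ => mnmDE s _ _)) big_split /= !V.
Qed.

Lemma cutlinU l k A i j :
  cutlin l k A ('e_i + 'e_j)%mnm = l i + l j + k * (A i (+) A j)%:R.
Proof.
have U (F : 'I_n -> R) (t : 'I_n) : \sum_s F s * (('e_t)%mnm s)%:R = F t.
  rewrite (bigD1 t)//= big1 ?addr0 => [|s ts].
    by rewrite mnm1E eqxx mulr1.
  by rewrite mnm1E eq_sym (negbTE ts) mulr0.
rewrite /cutlin; congr (_ + _ * _).
  rewrite -!(U l) -big_split /=; apply: eq_bigr => s _.
  by rewrite mnmDE natrD mulrDr.
by rewrite sum_U2; case: (A i); case: (A j).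
Qed.

(** Let [a] and [c] be the vector exp(l) restricted to [A] and to its complement. The form is u^2 +
    v^2 + 2 exp(k) u v in the coordinates u, v along [a] and [c], and on the hyperplane u + v = 0 it
    equals 2 v^2 (1 - exp(k)) <= 0. *)
Lemma at_most_one_pos_exp_cutlin l k A : 0 <= k ->
  at_most_one_pos_eigenvalue
    (\matrix_(i, j) expR (cutlin l k A ('e_i + 'e_j)%mnm) : 'M[R]_n).
Proof.
move=> k0; set M := (X in at_most_one_pos_eigenvalue X).
have U1 : 1 <= expR k by rewrite -expR0 ler_expR.
pose a : 'rV[R]_n := \row_i (expR (l i) * (A i)%:R).
pose c : 'rV[R]_n := \row_i (expR (l i) * (~~ A i)%:R).
have ME : M = a^T *m a + c^T *m c + expR k *: (a^T *m c + c^T *m a).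
  apply/matrixP => i j; rewrite !(mxE, big_ord1) cutlinU !expRD.
  by case: (A i); case: (A j); rewrite /= ?mulr1 ?mulr0 ?expR0; ring.
have symM : M^T = M by apply/matrixP => i j; rewrite !mxE addmC.
apply: (@at_most_one_pos_of_hyperplane _ _ _ (a + c)^T) => // x.
have qE (u v : 'rV[R]_n) : qform (u^T *m v) x x = (x *m u^T) 0 0 * (x *m v^T) 0 0.
  rewrite /qform !mulmxA -mulmxA [LHS]mxE big_ord1; congr (_ * _).
  by rewrite -[v *m x^T]trmxK trmx_mul trmxK mxE.
have qD (B C : 'M[R]_n) : qform (B + C) x x = qform B x x + qform C x x.
  by rewrite /qform mulmxDr mulmxDl mxE.
have qZ (t : R) (B : 'M[R]_n) : qform (t *: B) x x = t * qform B x x.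
  by rewrite /qform -scalemxAr -scalemxAl mxE.
rewrite linearD mulmxDr ME !qD qZ qD !qE => /matrixP/(_ 0 0).
rewrite mxE [RHS]mxE.
move: ((x *m a^T) 0 0) ((x *m c^T) 0 0) => u v /eqP; rewrite addr_eq0 => /eqP ->.
have := mulr_ge0 (sqr_ge0 v) (eq_ind_r is_true U1 (subr_ge0 _ _)); lra.
Qed.

End CutFunctions.

(** * Bounded ratios and their pairing with cut functions *)

Section BoundedRatios.
Context {R : realType} {n : nat}.

Lemma RwE (S : {fset multinom n}) (w : {ffun S -> R}) (f : mpoly n R) :
  (forall a, a \in S -> 0 < ncoeff f a) ->
  Rw w f = expR (\sum_(a : S) w a * ln (ncoeff f (val a))).
Proof.
move=> f0; rewrite expR_sum; apply: eq_bigr => a _.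
by rewrite /powR gt_eqF// f0// (valP a).
Qed.

Lemma BR_bounded {d} {S : {fset multinom n}} {w : {ffun S -> R}} :
  BR d S w -> exists M, forall f, lorentzian_pos d S f -> Rw w f <= M.
Proof.
rewrite /BR /=; set s := ereal_sup _ => hs.
exists (fine s) => f hf.
have : ((Rw w f)%:E <= s)%E by apply: ereal_sup_ubound; exists f.
by case: s hs => [r| |] //= _; rewrite ?lee_fin.
Qed.

Lemma BR_of_bounded d (S : {fset multinom n}) (w : {ffun S -> R}) M :
  (forall f, lorentzian_pos d S f -> Rw w f <= M) -> BR d S w.
Proof.
move=> h; apply: (@le_lt_trans _ _ M%:E); last exact: ltry.
by apply: ge_ereal_sup => _ [f hf <-]; rewrite lee_fin h.
Qed.

Lemma cutlinZ (t : R) (l : 'I_n -> R) k A (a : multinom n) :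
  cutlin (fun i => t * l i) (t * k) A a = t * cutlin l k A a.
Proof.
rewrite /cutlin mulrDr mulr_sumr mulrA; congr (_ + _).
by apply: eq_bigr => i _; rewrite mulrA.
Qed.

(* Along the Lorentzian polynomials with normalized coefficients
   [exp (t * cutlin a)], the ratio [Rw v] is [exp (t * pairing)], so that it is
   unbounded as soon as the pairing is positive. *)
Lemma BR_cutlin_le0 {S : {fset multinom n}} {v : {ffun S -> R}}
    (l : 'I_n -> R) k A :
  S =i simplex n 2 -> S != fset0 -> BR 2 S v -> 0 <= k ->
  \sum_(a : S) v a * cutlin l k A (val a) <= 0.
Proof.
move=> hS S0 /BR_bounded[M hM] k0; set s := (X in X <= 0).
rewrite leNgt; apply/negP => s0.
(* Chosen so that t s = |M|: the ratio is then exp(|M|) >= 1 + |M| > M. *)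
pose t := `|M| / s.
have t0 : 0 <= t by rewrite divr_ge0// ltW.
pose g (a : multinom n) := expR (cutlin (fun i => t * l i) (t * k) A a).
have gpos a : 0 < g a by exact: expR_gt0.
have := hM _ (poly_of_ncoeff_lorentzian_pos g S hS S0 gpos
                (at_most_one_pos_exp_cutlin _ _ A (mulr_ge0 t0 k0))).
have deg2 (a : multinom n) : a \in S -> mdeg a = 2 by rewrite hS in_simplex => /eqP.
rewrite RwE => [|a /deg2 ha]; last by rewrite ncoeff_poly_of_ncoeff.
have -> : \sum_(a : S) v a * ln (ncoeff (poly_of_ncoeff 2 g) (val a)) = t * s.
  rewrite mulr_sumr; apply: eq_bigr => a _.
  rewrite ncoeff_poly_of_ncoeff ?deg2 ?(valP a)// expRK cutlinZ.
  by rewrite mulrCA.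
rewrite divfK ?gt_eqF// leNgt => /negP; apply.
apply: (@lt_le_trans _ _ (1 + `|M|)); last exact: expR_ge1Dx.
by rewrite ltr_pwDl// ler_norm.
Qed.

End BoundedRatios.

(** * Local generators and polars of cones *)

Section Generators.
Context {R : realType} {n : nat}.

Lemma link_simplex d b : (2 <= d)%N -> b \in simplex n (d - 2) ->
  link (simplex n d) b =i simplex n 2.
Proof.
rewrite in_simplex => d2 /eqP hb a; rewrite in_simplex; apply/idP/eqP.
  by move=> /imfset2P[i _ [j _ ->]]; rewrite mdegD !mdeg1.
move=> /[dup] ha /mdeg2_sum[i [j e]]; apply/imfset2P; exists i => //.
exists j => //=; rewrite inE/= -e in_simplex mdegD hb ha; apply/eqP; lia.
Qed.

(** An extension by zero sees [q] only on the translate of the link by [b], so polarity against the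
    generators becomes a local condition. *)
Lemma pairing_extend (S : {fset multinom n}) b (v : {ffun link S b -> R})
    (q : {ffun S -> R}) (F : multinom n -> R) :
  (forall a, q a = F (val a)) ->
  pairing (extend v) q = \sum_(g : link S b) v g * F (b + val g)%mnm.
Proof.
move=> qF; rewrite /pairing.
under eq_bigr do rewrite ffunE mulr_suml.
rewrite exchange_big /=; apply: eq_bigr => g _.
have hg : (b + val g)%mnm \in S.
  by have /imfset2P[i _ [j /= h ->]] := valP g; move: h; rewrite inE.
rewrite (bigD1 [` hg]%fset)//= big1 ?addr0.
  by rewrite eqxx mulr1 qF.
move=> a ha; rewrite (_ : (val a == _) = false) ?mulr0 ?mul0r//.
by apply: contraNF ha => /eqP e; apply/eqP/val_inj.
Qed.

End Generators.

Section Cones.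
Context {R : realType} {I : finType}.

Lemma polar_cone (E : set {ffun I -> R}) q :
  (forall u, E u -> pairing u q <= 0) -> polar (cone E) q.
Proof.
move=> h w [k [l [u [hu ->]]]]; rewrite /pairing.
under eq_bigr do rewrite ffunE mulr_suml.
rewrite exchange_big /=; apply: sumr_le0 => t _.
have [l0 /h] := hu t; rewrite /pairing => ut.
under eq_bigr do rewrite -mulrA; rewrite -mulr_sumr.
by rewrite mulr_ge0_le0.
Qed.

End Cones.

(** * Local structure of [qd] *)

(** [qd] as a function on all exponents, which can be evaluated at b + a without a membership
    proof. *)
Definition qfun {R : realType} (d : nat) (a : multinom 4) : R :=
  (mu d (a (inord 1) + a (inord 2)))%:R + (mu d (a (inord 2) + a (inord 3)))%:R
  - (eps d)%:R * (a == alpha_star d)%:R.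

Lemma mnm4_eqE (a b : multinom 4) :
  (a == b) = [&& a (inord 0) == b (inord 0), a (inord 1) == b (inord 1),
                 a (inord 2) == b (inord 2) & a (inord 3) == b (inord 3)].
Proof.
apply/eqP/and4P => [->|[/eqP h0 /eqP h1 /eqP h2 /eqP h3]]; first by [].
by apply/mnmP => i; rewrite -(inord_val i); case: i => -[|[|[|[|]]]].
Qed.

Lemma mdeg4E (a : multinom 4) :
  mdeg a = (a (inord 0) + a (inord 1) + a (inord 2) + a (inord 3))%N.
Proof.
rewrite mdegE !big_ord_recl big_ord0 addn0 !addnA.
by congr (a _ + a _ + a _ + a _)%N; apply: val_inj; rewrite /= inordK.
Qed.

Lemma mnm4E i j k l :
  ((mnm4 i j k l (inord 0) = i) * (mnm4 i j k l (inord 1) = j) *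
   (mnm4 i j k l (inord 2) = k) * (mnm4 i j k l (inord 3) = l))%type.
Proof. by do !split; rewrite /mnm4 multinomE (tnth_nth 0%N) /= inordK. Qed.

Lemma alpha_starE d :
  [/\ alpha_star d (inord 0) = ((d - 4)./2 + 2)%N, alpha_star d (inord 1) = 0%N,
      alpha_star d (inord 2) = (uphalf (d - 4) + 2)%N & alpha_star d (inord 3) = 0%N].
Proof.
by rewrite /alpha_star /gam /= !mnmDE !mnm4E.
Qed.

Lemma mu_concave d s : (s + 2 <= d)%N -> (mu d s + mu d (s + 2) <= 2 * mu d (s + 1))%N.
Proof. rewrite /mu; lia. Qed.

(** The point [uphalf (d - 4) + 2] is d/2 rounded up, where mu_d peaks. The second difference there
    is -2 for even d, and -1 for odd d because the peak is then a plateau of two points; this is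
    where [eps] comes from. *)
Lemma mu_kink d s : (4 <= d)%N -> (s + 1 = uphalf (d - 4) + 2)%N ->
  (2 * mu d (s + 1) = mu d s + mu d (s + 2) + eps d)%N.
Proof.
by move=> d4; rewrite /mu /eps; case: ifP; lia.
Qed.

Section CutIdentities.
Context {R : realType} {n : nat}.
Implicit Types (a : multinom n) (A : pred 'I_n).

(** Summed against an exponent a of degree 2, this gives the affine function of a(A) that
    interpolates h(s + a(A)) at a(A) = 0 and a(A) = 2; the constant h(s) is split evenly over the
    two units of degree. *)
Definition interp_lin (h : nat -> R) (s : nat) A (i : 'I_n) : R :=
  h s / 2 + (h (s + 2)%N - h s) / 2 * (A i)%:R.

(** As a(A) takes only the values 0, 1 and 2, the interpolation error is concentrated at a(A) = 1,
    which is a cut term. *)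
Lemma cutlin_interp (h : nat -> R) s A a : mdeg a = 2 ->
  h (s + \sum_(i | A i) a i)%N =
  cutlin (interp_lin h s A) (h (s + 1)%N - (h s + h (s + 2)%N) / 2) A a.
Proof.
move=> /mdeg2_sum[i [j ->]]; rewrite sum_U2 cutlinU /interp_lin.
by case: (A i); case: (A j); rewrite /= ?addn0 ?add0n; lra.
Qed.

Lemma cutlin_square (e : R) i a : mdeg a = 2 ->
  - e * (a i == 2)%:R = cutlin (fun j => - (e / 2) * (j == i)%:R) (e / 2) (pred1 i) a.
Proof.
move=> /mdeg2_sum[j [k ->]]; rewrite cutlinU mnmDE !mnm1E /=.
by case: (j == i); case: (k == i); rewrite /=; lra.
Qed.

End CutIdentities.

(* The coordinates alpha_1, ..., alpha_4 are those of index 0, ..., 3. *)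
Definition inset (s : seq nat) : pred 'I_4 := fun i => val i \in s.

(** [alpha_star] is supported on the first and third variables. Hence the correction is visible only
    from b = alpha_star - 2 e_1, alpha_star - 2 e_3 or alpha_star - e_1 - e_3, the three cases
    treated first, in this order. *)
Lemma qd_local_cuts {R : realType} d (b : multinom 4) : (4 <= d)%N -> mdeg b = (d - 2)%N ->
  exists (l1 l2 l3 : 'I_4 -> R) (k1 k2 k3 : R) (A1 A2 A3 : pred 'I_4),
    [/\ 0 <= k1, 0 <= k2, 0 <= k3 &
    forall a, mdeg a = 2 ->
      qfun d (b + a)%mnm = cutlin l1 k1 A1 a + cutlin l2 k2 A2 a + cutlin l3 k3 A3 a].
Proof.
move=> d4 hb.
pose h s : R := (mu d s)%:R; pose e : R := (eps d)%:R.
pose s := (b (inord 1) + b (inord 2))%N; pose t := (b (inord 2) + b (inord 3))%N.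
pose kink s := h (s + 1)%N - (h s + h (s + 2)%N) / 2.
have kink_ge0 u : (u + 2 <= d)%N -> 0 <= kink u.
  move=> /mu_concave; rewrite -(ler_nat R) natrD natrM /kink /h; lra.
have hb4 := mdeg4E b.
have ks0 : 0 <= kink s by apply: kink_ge0; rewrite /s; lia.
have kt0 : 0 <= kink t by apply: kink_ge0; rewrite /t; lia.
have e0 : 0 <= e / 2 by rewrite divr_ge0.
have sumA (i j : nat) (a : multinom 4) : (i < j < 4)%N ->
    (\sum_(k | inset [:: i; j] k) a k = a (inord i) + a (inord j))%N.
  move=> /andP[ij j4]; have i4 := ltn_trans ij j4.
  rewrite (bigD1 (inord i)) /=; last by rewrite /inset inE /= inordK ?eqxx.
  congr addn; rewrite (big_pred1 (inord j))// => k.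
  rewrite /inset !inE -!val_eqE /= !inordK//; lia.
have qE a : mdeg a = 2 -> qfun d (b + a)%mnm =
    cutlin (interp_lin h s (inset [:: 1; 2])) (kink s) (inset [:: 1; 2]) a
    + cutlin (interp_lin h t (inset [:: 2; 3])) (kink t) (inset [:: 2; 3]) a
    - e * ((b + a)%mnm == alpha_star d)%:R.
  move=> ha; rewrite -!cutlin_interp// /h !sumA// /qfun !mnmDE.
  by rewrite (addnACA _ (a (inord 1))) (addnACA _ (a (inord 2))).
have [ea0 ea1 ea2 ea3] := alpha_starE d.
have alphaE a : ((b + a)%mnm == alpha_star d) =
    [&& b (inord 0) + a (inord 0) == (d - 4)./2 + 2, b (inord 1) + a (inord 1) == 0,
        b (inord 2) + a (inord 2) == uphalf (d - 4) + 2 &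
        b (inord 3) + a (inord 3) == 0]%N.
  by rewrite mnm4_eqE ea0 ea1 ea2 ea3 !mnmDE.
have [c0|c0] := boolP [&& b (inord 0) + 2 == (d - 4)./2 + 2, b (inord 1) == 0,
    b (inord 2) == uphalf (d - 4) + 2 & b (inord 3) == 0]%N.
  exists (interp_lin h s (inset [:: 1; 2])), (interp_lin h t (inset [:: 2; 3])).
  exists (fun j => - (e / 2) * (j == inord 0)%:R).
  exists (kink s), (kink t), (e / 2), (inset [:: 1; 2]), (inset [:: 2; 3]), (pred1 (inord 0)).
  split=> // a ha; rewrite qE// -cutlin_square// mulNr; congr (_ - _ * (_ : bool)%:R).
  by have ha4 := mdeg4E a; rewrite alphaE; lia.
have [c2|c2] := boolP [&& b (inord 0) == (d - 4)./2 + 2, b (inord 1) == 0,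
    b (inord 2) + 2 == uphalf (d - 4) + 2 & b (inord 3) == 0]%N.
  exists (interp_lin h s (inset [:: 1; 2])), (interp_lin h t (inset [:: 2; 3])).
  exists (fun j => - (e / 2) * (j == inord 2)%:R).
  exists (kink s), (kink t), (e / 2), (inset [:: 1; 2]), (inset [:: 2; 3]), (pred1 (inord 2)).
  split=> // a ha; rewrite qE// -cutlin_square// mulNr; congr (_ - _ * (_ : bool)%:R).
  by have ha4 := mdeg4E a; rewrite alphaE; lia.
have [c1|c1] := boolP [&& b (inord 0) + 1 == (d - 4)./2 + 2, b (inord 1) == 0,
    b (inord 2) + 1 == uphalf (d - 4) + 2 & b (inord 3) == 0]%N.
  exists (interp_lin h s (inset [:: 1; 2])), (interp_lin h t (inset [:: 2; 3])).
  exists (fun=> 0), (e / 2), (e / 2), 0, (inset [:: 1]), (inset [:: 3]), (inset [::]).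
  split=> // a ha; rewrite qE//.
  (* As b vanishes at the second and fourth variables, both [s + 1] and [t + 1] are the peak of
     mu_d. Both cut weights are thus e / 2, exactly what the correction e [e_1 + e_3] needs in the
     cut identity. *)
  have kinkE u : (u + 1 = uphalf (d - 4) + 2)%N -> kink u = e / 2.
    move=> /(mu_kink _ _ d4)/(congr1 (fun m => m%:R : R)).
    rewrite natrM !natrD /kink /h /e; lra.
  rewrite !kinkE; [|rewrite /t; lia..].
  have -> : ((b + a)%mnm == alpha_star d) = (a (inord 0) == 1%N) && (a (inord 2) == 1%N).
    by have ha4 := mdeg4E a; rewrite alphaE; lia.
  move: ha => /mdeg2_sum[i [j ->]]; rewrite !cutlinU !mnmDE !mnm1E.
  move: (interp_lin _ _ _) (interp_lin _ _ _) => L1 L2.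
  rewrite -!val_eqE /= !inordK// /inset !inE.
  case: i => [[|[|[|[|//]]]] ?]; case: j => [[|[|[|[|//]]]] ?]; rewrite /=; lra.
(* Here b + a never equals [alpha_star], and the third cut function is zero. *)
exists (interp_lin h s (inset [:: 1; 2])), (interp_lin h t (inset [:: 2; 3])).
exists (fun=> 0), (kink s), (kink t), 0, (inset [:: 1; 2]), (inset [:: 2; 3]), (inset [::]).
split=> // a ha; rewrite qE// [X in _ = _ + X]/cutlin mul0r big1 ?addr0 => [|i _]; last first.
  by rewrite mul0r.
have -> : ((b + a)%mnm == alpha_star d) = false.
  by have ha4 := mdeg4E a; rewrite alphaE; lia.
by rewrite mulr0 subr0.
Qed.

(** * The bound on [Rd] *)

Lemma mnm4_addU a b c e :
  (((mnm4 a b c e + 'e_(inord 0))%mnm = mnm4 a.+1 b c e) *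
   ((mnm4 a b c e + 'e_(inord 1))%mnm = mnm4 a b.+1 c e) *
   ((mnm4 a b c e + 'e_(inord 2))%mnm = mnm4 a b c.+1 e) *
   ((mnm4 a b c e + 'e_(inord 3))%mnm = mnm4 a b c e.+1))%type.
Proof.
by do !split; apply/eqP; rewrite mnm4_eqE !mnmDE !mnm1E -!val_eqE /= !inordK//=;
  rewrite !mnm4E ?addn0 ?addn1 ?eqxx.
Qed.

Lemma mdeg_mnm4 a b c e : mdeg (mnm4 a b c e) = (a + b + c + e)%N.
Proof. by rewrite mdeg4E !mnm4E. Qed.

Lemma mdeg_gam d : mdeg (gam d) = (d - 4)%N.
Proof. rewrite /gam mdeg_mnm4; lia. Qed.

Section LocalIndices.
Context {d : nat}.

Lemma num_idx_sub : (4 <= d)%N -> {subset num_idx d <= simplex 4 d}.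
Proof.
by move=> d4 a; rewrite !inE => /or3P[] /eqP ->;
  rewrite in_simplex mdegD mdeg_gam mdeg_mnm4 subnK.
Qed.

Lemma den_idx_sub : (4 <= d)%N -> {subset den_idx d <= simplex 4 d}.
Proof.
by move=> d4 a; rewrite !inE => /or3P[] /eqP ->;
  rewrite in_simplex mdegD mdeg_gam mdeg_mnm4 subnK.
Qed.

Lemma idx_uniq : uniq (num_idx d ++ den_idx d).
Proof.
rewrite /num_idx /den_idx /alpha_star /= !inE.
by rewrite !eqm_add2l.
Qed.

Lemma sum_mem_uniq {R : realType} {n} (S : {fset multinom n}) (s : seq (multinom n))
    (F : multinom n -> R) : uniq s -> {subset s <= S} ->
  \sum_(a : S) (val a \in s)%:R * F (val a) = \sum_(x <- s) F x.
Proof.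
move=> us sS; transitivity (\sum_(x <- s) \sum_(a : S) (val a == x)%:R * F (val a)).
  rewrite exchange_big /=; apply: eq_bigr => a _.
  rewrite -mulr_suml; congr (_ * _); rewrite -natr_sum; congr (_%:R).
  rewrite -count_uniq_mem// -sum1_count big_mkcond /=.
  by apply: eq_bigr => x _; rewrite eq_sym; case: eqP.
rewrite !big_seq; apply: eq_bigr => x /sS xS.
rewrite (bigD1 [` xS]%fset)//= eqxx mul1r big1 ?addr0// => a ax.
rewrite (_ : (val a == x) = false) ?mul0r//.
by apply: contraNF ax => /eqP e; apply/eqP/val_inj.
Qed.

(** The six indices are distinct, so the nested tests in [wd] amount to a difference of two
    indicator functions. *)
Lemma sum_wd {R : realType} (F : multinom 4 -> R) : (4 <= d)%N ->
  \sum_(a : simplex 4 d) wd d a * F (val a) =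
  \sum_(x <- num_idx d) F x - \sum_(x <- den_idx d) F x.
Proof.
move=> d4; have := idx_uniq; rewrite cat_uniq => /and3P[un /hasPn dis ud].
rewrite -(sum_mem_uniq (simplex 4 d) _ F un (num_idx_sub d4)).
rewrite -(sum_mem_uniq (simplex 4 d) _ F ud (den_idx_sub d4)).
rewrite -sumrB; apply: eq_bigr => a _; rewrite ffunE -mulrBl; congr (_ * _).
case hn: (_ \in num_idx d); case hd: (_ \in den_idx d); rewrite ?subr0 ?sub0r//.
by have := dis (val a) hd; rewrite /= hn.
Qed.

End LocalIndices.

Lemma prod4_le {R : realFieldType} (p1 p2 p3 p4 q1 q2 q3 q4 : R) :
  0 < p1 -> 0 < p2 -> 0 < p3 -> 0 < p4 ->
  p1 <= 2 * q1 -> p2 <= 2 * q2 -> p3 <= 2 * q3 -> p4 <= 2 * q4 ->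
  p1 * p2 * (p3 * p4) <= 16 * (q1 * q2 * (q3 * q4)).
Proof.
move=> p10 p20 p30 p40 h1 h2 h3 h4.
have -> : 16 * (q1 * q2 * (q3 * q4)) = 2 * q1 * (2 * q2) * (2 * q3 * (2 * q4)) by ring.
by apply: ler_pM; rewrite ?mulr_ge0 ?ler_pM// ltW.
Qed.

(* Multiplying the four [t]-inequalities bounds the summand [e * g], and
   multiplying the four [u]-inequalities bounds the summand [h * k]. *)
Lemma ratio_bound_arith {R : realFieldType}
    (x m n p q a b g e k h z y1 y2 y3 : R) :
  0 < x -> 0 < m -> 0 < n -> 0 < p -> 0 < q -> 0 < a -> 0 < b ->
  0 < g -> 0 < e -> 0 < k -> 0 < h ->
  x * z <= 2 * (e * g + h * k) ->
  a * x <= 2 * (m * n) -> p * g <= 2 * (x * y2) ->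
  b * n <= 2 * (y1 * p) -> m * e <= 2 * (y3 * x) ->
  q * k <= 2 * (y3 * x) -> b * x <= 2 * (q * p) ->
  n * h <= 2 * (x * y2) -> a * p <= 2 * (y1 * n) ->
  a * b * z <= 64 * (y1 * y2 * y3).
Proof.
move=> x0 m0 n0 p0 q0 a0 b0 g0 e0 k0 h0 F t1 t2 t3 t4 u1 u2 u3 u4.
have eg : a * b * (e * g) <= 16 * (y1 * y2 * y3) * x.
  have := prod4_le _ _ _ _ _ _ _ _ _ _ _ _ t1 t2 t3 t4; rewrite !mulr_gt0//.
  move=> /(_ isT isT isT isT); set l := (X in X <= _); set r := (X in _ <= X).
  have -> : l = m * n * p * x * (a * b * (e * g)) by rewrite /l; ring.
  have -> : r = m * n * p * x * (16 * (y1 * y2 * y3) * x) by rewrite /r; ring.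
  by rewrite ler_pM2l// !mulr_gt0.
have hk : a * b * (h * k) <= 16 * (y1 * y2 * y3) * x.
  have := prod4_le _ _ _ _ _ _ _ _ _ _ _ _ u1 u2 u3 u4; rewrite !mulr_gt0//.
  move=> /(_ isT isT isT isT); set l := (X in X <= _); set r := (X in _ <= X).
  have -> : l = q * p * n * x * (a * b * (h * k)) by rewrite /l; ring.
  have -> : r = q * p * n * x * (16 * (y1 * y2 * y3) * x) by rewrite /r; ring.
  by rewrite ler_pM2l// !mulr_gt0.
rewrite -(ler_pM2l x0); have := ler_wpM2l (ltW (mulr_gt0 a0 b0)) F.
by lra.
Qed.

Section RatioBound.
Context {R : realType} {d : nat} {f : mpoly 4 R}.

Lemma simplex_coeff_gt0 n (g : mpoly n R) a :
  lorentzian_pos d (simplex n d) g -> a \in simplex n d -> 0 < ncoeff g a.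
Proof. by move=> [_ h] ha; apply/h. Qed.

Let c i j k l := ncoeff f (gam d + mnm4 i j k l)%mnm.

Lemma RwE_Rd : (4 <= d)%N -> lorentzian_pos d (simplex 4 d) f -> Rw (wd d) f = Rd d f.
Proof.
move=> d4 hf.
have c0 i j k l : (i + j + k + l = 4)%N -> 0 < c i j k l.
  move=> e; apply: simplex_coeff_gt0 hf _.
  by rewrite in_simplex mdegD mdeg_gam mdeg_mnm4 e subnK.
transitivity (expR (ln (c 1 0 3 0) + (ln (c 3 0 1 0) + ln (c 0 2 0 2)) -
                    (ln (c 2 0 2 0) + (ln (c 1 0 1 2) + ln (c 1 2 1 0))))).
  rewrite RwE => [|a]; last exact: simplex_coeff_gt0.
  rewrite (sum_wd (fun a => ln (ncoeff f a))) //.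
  rewrite /num_idx /den_idx /alpha_star.
  by rewrite 2!big_cons big_seq1 2!big_cons big_seq1.
have -> : Rd d f = c 1 0 3 0 * c 3 0 1 0 * c 0 2 0 2 /
                   (c 2 0 2 0 * c 1 0 1 2 * c 1 2 1 0) by [].
move: (c0 1 0 3 0 erefl) (c0 3 0 1 0 erefl) (c0 0 2 0 2 erefl)
      (c0 2 0 2 0 erefl) (c0 1 0 1 2 erefl) (c0 1 2 1 0 erefl)%N.
move: (c _ _ _ _) (c _ _ _ _) (c _ _ _ _) (c _ _ _ _) (c _ _ _ _) (c _ _ _ _).
move=> u1 u2 u3 u4 u5 u6 h1 h2 h3 h4 h5 h6.
by rewrite expRB 4!expRD !lnK ?posrE// !mulrA.
Qed.

Lemma Rd_le64 : (4 <= d)%N -> lorentzian_pos d (simplex 4 d) f -> Rd d f <= 64.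
Proof.
move=> d4 hf.
have c0 i j k l : (i + j + k + l = 4)%N -> 0 < c i j k l.
  move=> e; apply: simplex_coeff_gt0 hf _.
  by rewrite in_simplex mdegD mdeg_gam mdeg_mnm4 e subnK.
pose H i j k l := hess f (gam d + mnm4 i j k l)%mnm.
have HP i j k l : (i + j + k + l = 2)%N ->
    [/\ (H i j k l)^T = H i j k l, at_most_one_pos_eigenvalue (H i j k l) &
        forall u v, 0 < H i j k l u v].
  move=> e; split.
  - by apply/matrixP => u v; rewrite !mxE -!addmA (addmC ('e_v)%mnm).
  - have [[_ _ _ h] _] := hf; apply: h.
    rewrite in_simplex mdegD mdeg_gam mdeg_mnm4 e; lia.
  - move=> u v; rewrite mxE; apply: simplex_coeff_gt0 hf _.
    rewrite in_simplex !mdegD !mdeg1 mdeg_gam mdeg_mnm4 e; lia.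
have T i j k l (u v w : nat) : (i + j + k + l = 2)%N ->
    H i j k l (inord u) (inord u) * H i j k l (inord v) (inord w) <=
    2 * (H i j k l (inord u) (inord v) * H i j k l (inord u) (inord w)).
  by move=> /HP[h1 h2 h3]; exact: lorentz_three_term.
have hE i j k l u v : H i j k l u v = ncoeff f (gam d + (mnm4 i j k l + 'e_u + 'e_v))%mnm.
  by rewrite mxE -!addmA.
have F : c 1 1 1 1 * c 0 2 0 2 <= 2 * (c 1 2 0 1 * c 0 1 1 2 + c 1 1 0 2 * c 0 2 1 1).
  have [h1 h2 h3] := HP 0 1 0 1 erefl.
  have := lorentz_four_term _ (inord 0) (inord 2) (inord 1) (inord 3) h1 h2 h3.
  by rewrite !hE !mnm4_addU.
(* In [T i j k l u v w] the first four arguments locate the Hessian and u is the repeated index. The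
   t-inequalities serve the summand c_1201 c_0112 of [F], the u-inequalities the summand c_1102
   c_0211. *)
have t1 : c 1 0 3 0 * c 1 1 1 1 <= 2 * (c 1 1 2 0 * c 1 0 2 1).
  by have := T 1 0 1 0 2 1 3 erefl; rewrite !hE !mnm4_addU.
have t2 : c 2 0 1 1 * c 0 1 1 2 <= 2 * (c 1 1 1 1 * c 1 0 1 2).
  by have := T 0 0 1 1 0 1 3 erefl; rewrite !hE !mnm4_addU.
have t3 : c 3 0 1 0 * c 1 0 2 1 <= 2 * (c 2 0 2 0 * c 2 0 1 1).
  by have := T 1 0 1 0 0 2 3 erefl; rewrite !hE !mnm4_addU.
have t4 : c 1 1 2 0 * c 1 2 0 1 <= 2 * (c 1 2 1 0 * c 1 1 1 1).
  by have := T 1 1 0 0 2 1 3 erefl; rewrite !hE !mnm4_addU.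
have u1 : c 2 1 1 0 * c 0 2 1 1 <= 2 * (c 1 2 1 0 * c 1 1 1 1).
  by have := T 0 1 1 0 0 1 3 erefl; rewrite !hE !mnm4_addU.
have u2 : c 3 0 1 0 * c 1 1 1 1 <= 2 * (c 2 1 1 0 * c 2 0 1 1).
  by have := T 1 0 1 0 0 1 3 erefl; rewrite !hE !mnm4_addU.
have u3 : c 1 0 2 1 * c 1 1 0 2 <= 2 * (c 1 1 1 1 * c 1 0 1 2).
  by have := T 1 0 0 1 2 1 3 erefl; rewrite !hE !mnm4_addU.
have u4 : c 1 0 3 0 * c 2 0 1 1 <= 2 * (c 2 0 2 0 * c 1 0 2 1).
  by have := T 1 0 1 0 2 0 3 erefl; rewrite !hE !mnm4_addU.
have -> : Rd d f = c 1 0 3 0 * c 3 0 1 0 * c 0 2 0 2 /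
                   (c 2 0 2 0 * c 1 0 1 2 * c 1 2 1 0) by [].
rewrite ler_pdivrMr; last by apply: mulr_gt0; [apply: mulr_gt0|]; exact: c0.
move: {T} F t1 t2 t3 t4 u1 u2 u3 u4.
(* In [ratio_bound_arith], x is c_1111, the numerator of R_d is a b z, the denominator is y1 y2 y3 =
   c_2020 c_1012 c_1210, and m, n, p, q are the auxiliary coefficients c_1120, c_1021, c_2011,
   c_2110 that cancel. *)
move: (c0 1 1 1 1 erefl) (c0 1 1 2 0 erefl) (c0 1 0 2 1 erefl) (c0 2 0 1 1 erefl)
  (c0 2 1 1 0 erefl) (c0 1 0 3 0 erefl) (c0 3 0 1 0 erefl) (c0 0 1 1 2 erefl)
  (c0 1 2 0 1 erefl) (c0 0 2 1 1 erefl) (c0 1 1 0 2 erefl)%N.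
exact: ratio_bound_arith.
Qed.

End RatioBound.

(** * The pairing, polarity on the generators, and the conclusion *)

Lemma pairing_wd_qd {R : realType} d : (4 <= d)%N ->
  pairing (wd d) (qd d) = (eps d)%:R :> R.
Proof.
move=> d4; rewrite /pairing.
rewrite (eq_bigr (fun a => wd d a * qfun d (val a))) => [|a _]; last by rewrite [qd d a]ffunE.
(* With b = [uphalf (d - 4)], numerator and denominator both evaluate mu_d twice at each of b + 1, b
   + 2 and b + 3. These values cancel, leaving the correction at [alpha_star], whose weight in [wd]
   is -1. *)
rewrite sum_wd// /num_idx /den_idx /alpha_star 2!big_cons big_seq1 2!big_cons big_seq1 /qfun.
rewrite !mnmDE /alpha_star !eqm_add2l /gam !mnm4E.
rewrite !mnm4_eqE !mnm4E /= !add0n ?addn0 ?mulr0 ?mulr1 ?subr0.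
by rewrite -addnA !(addnC 2) -addnA; ring.
Qed.

Lemma qd_nonpos_on_generators {R : realType} d (u : {ffun simplex 4 d -> R}) :
  (4 <= d)%N -> generators d (simplex 4 d) u -> pairing u (qd d) <= 0.
Proof.
move=> d4 [b [/= hb S0] [v hv <-]].
have d2 : (2 <= d)%N by exact: leq_trans d4.
rewrite (pairing_extend _ _ _ _ (qfun d)) => [|a]; last by rewrite ffunE.
have hS := link_simplex _ _ d2 hb.
move: (hb); rewrite in_simplex => /eqP hb'.
have [l1 [l2 [l3 [k1 [k2 [k3 [A1 [A2 [A3 [k10 k20 k30 hq]]]]]]]]]] :=
  qd_local_cuts (R := R) d b d4 hb'.
rewrite (eq_bigr (fun g => v g * cutlin l1 k1 A1 (val g) + v g * cutlin l2 k2 A2 (val g)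
                           + v g * cutlin l3 k3 A3 (val g))).
  rewrite !big_split /=.
  have := BR_cutlin_le0 l1 k1 A1 hS S0 hv k10.
  have := BR_cutlin_le0 l2 k2 A2 hS S0 hv k20.
  have := BR_cutlin_le0 l3 k3 A3 hS S0 hv k30.
  move: (\sum_g _) (\sum_g _) (\sum_g _) => x y z; lra.
move=> g _; rewrite hq ?mulrDr//; apply/eqP; rewrite -in_simplex -hS; exact: valP.
Qed.

Theorem theorem5p1 (R : realType) (d : nat) (hd : (4 <= d)%N) :
  let G : set {ffun simplex 4 d -> R} := generators d (simplex 4 d) in
  [/\ (BR d (simplex 4 d) `\` cone G) (wd d),
      forall f : mpoly 4 R, lorentzian_pos d (simplex 4 d) f -> Rd d f <= 64,
      pairing (wd d) (qd d) = (eps d)%:R :> R,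
      (0 < (eps d)%:R :> R)
    & polar (cone G) (qd d)].
Proof.
move=> G.
have le64 (f : mpoly 4 R) : lorentzian_pos d (simplex 4 d) f -> Rd d f <= 64.
  exact: Rd_le64.
have pol : polar (cone G) (qd d).
  by apply: polar_cone => u; exact: qd_nonpos_on_generators.
have e0 : 0 < (eps d)%:R :> R by rewrite ltr0n /eps; case: odd.
have pe : pairing (wd d) (qd d) = (eps d)%:R :> R.
  exact: pairing_wd_qd.
split=> //; split; last first.
  (* Membership in the cone would force the positive pairing [eps d] to be nonpositive. *)
  by move=> /pol; rewrite pe leNgt e0.
by apply: (BR_of_bounded _ _ _ 64) => f hf; rewrite RwE_Rd// le64.
Qed.
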